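(* Let $\mathcal{X}_{f,g}$ be a curve over $\mathbb{F}_q$ with rational points $P_1,\ldots,P_{a+1}$ satisfying the hypotheses listed in the context, let $2\leq m\leq a+1$, assume $q\geq m$, and let $\mathbf{P}_m=(P_1,\ldots,P_m)$. Set $$\boldsymbol{\beta}^{0,m}=(b(m-2),0,\ldots,0)\in\mathbb{Z}^m \quad\text{and}\quad \boldsymbol{\beta}^{i,m}=(a(b-i)-b,i,\ldots,i)\in\mathbb{Z}^m \ \text{ for } i=1,\ldots,b-1,$$ and $\mathcal{C}(\mathbf{P}_m)=\{\boldsymbol{\beta}\in\mathbb{Z}^m : 0\leq\beta_i<b \text{ for } i=2,\ldots,m\}$. Then $$\widehat{\Lambda}(\mathbf{P}_m)\cap\mathcal{C}(\mathbf{P}_m)=\{\boldsymbol{\beta}^{i,m} : i=0,1,\ldots,b-1\}.$$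
   Context: Hypotheses on the curve: $\mathcal{X}_{f,g}$ is a nonsingular, projective, geometrically irreducible algebraic curve over $\mathbb{F}_q$ of positive genus, admitting a plane model of type $f(y)=g(x)$, where $f(T),g(T)\in\mathbb{F}_q[T]$ with $\deg f=a$, $\deg g=b$ and $\gcd(a,b)=1$; its genus is $(a-1)(b-1)/2$. There are $a+1$ distinct rational points $P_1,\ldots,P_{a+1}$ on $\mathcal{X}_{f,g}$ such that $aP_1\sim P_2+\cdots+P_{a+1}$ and $bP_1\sim bP_j$ for all $j\in\{2,\ldots,a+1\}$, where $b$ is the smallest positive integer satisfying the latter condition, and $\sim$ is linear equivalence of divisors. Relative maximal elements: let $\mathbf{Q}=(Q_1,\ldots,Q_m)$ be an $m$-tuple of distinct rational points on a curve $\mathcal{X}$ and $I=\{1,\ldots,m\}$. Let $R_{\mathbf{Q}}$ be the set of functions in $\mathbb{F}_q(\mathcal{X})$ regular outside $\{Q_1,\ldots,Q_m\}$ and $\widehat{H}(\mathbf{Q})=\{(-v_{Q_1}(h),\ldots,-v_{Q_m}(h))\in\mathbb{Z}^m : h\in R_{\mathbf{Q}}\setminus\{0\}\}$, where $v_{Q_i}$ is the valuation at $Q_i$. For $\boldsymbol{\alpha}\in\mathbb{Z}^m$ and a nonempty $J\subsetneq I$, let $\nabla_J(\boldsymbol{\alpha})=\{\boldsymbol{\beta}\in\widehat{H}(\mathbf{Q}) : \beta_j=\alpha_j \text{ for } j\in J \text{ and } \beta_i<\alpha_i \text{ for } i\notin J\}$, and let $\nabla(\boldsymbol{\alpha})=\bigcup_{i=1}^m\nabla_{\{i\}}(\boldsymbol{\alpha})$.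 An element $\boldsymbol{\alpha}\in\widehat{H}(\mathbf{Q})$ is relative maximal if $\nabla(\boldsymbol{\alpha})=\emptyset$ and $\nabla_J(\boldsymbol{\alpha})\neq\emptyset$ for every $J\subsetneq I$ with $\#J\geq 2$. $\widehat{\Lambda}(\mathbf{Q})$ denotes the set of relative maximal elements of $\widehat{H}(\mathbf{Q})$. *)

(* Defs.v *)
From HB Require Import structures.
From mathcomp Require Import all_boot all_order all_algebra.
From mathcomp Require Import boolp classical_sets.
From mathcomp Require Import freeg.

Set Implicit Arguments.
Unset Strict Implicit.
Unset Printing Implicit Defensive.
Import Order.TTheory GRing.Theory Num.Theory.
Local Open Scope classical_set_scope.
Local Open Scope ring_scope.

(* A nonsingular projective irreducible curve over a field k is handled through
   its function field F, given with the embedding iota : k -> F.  Its (closed)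
   points are the places of F / k, and its rational points are the places of
   degree one. *)

Section FunctionField.
Variables (k F : fieldType) (iota : {rmorphism k -> F}).

Definition rational_in (x z : F) : Prop :=
  exists p q : {poly k},
    q != 0 /\ z = (map_poly iota p).[x] / (map_poly iota q).[x].

(* F is a finite extension of k(x) for some x transcendental over k. *)
Definition function_field : Prop :=
  exists x : F, ~ algebraicOver iota x /\
    exists (n : nat) (e : 'I_n -> F), forall z : F, exists c : 'I_n -> F,
      (forall i, rational_in x (c i)) /\ z = \sum_i c i * e i.

(* For every extension L of k, the ring F (x)_k L is a domain: it embeds in a
   field E, injectivity of F (x)_k L -> E being the last condition. *)
Definition geometrically_irreducible : Prop :=
  forall (L : fieldType) (j : {rmorphism k -> L}),
  exists (E : fieldType) (u : {rmorphism F -> E}) (w : {rmorphism L -> E}),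
    (forall c : k, u (iota c) = w (j c)) /\
    (forall (n : nat) (s : 'I_n -> L),
       (forall c : 'I_n -> k, \sum_i j (c i) * s i = 0 -> forall i, c i = 0) ->
       forall d : 'I_n -> F, \sum_i u (d i) * w (s i) = 0 -> forall i, d i = 0).

(* F is the fraction field of k[X, Y] / (f(Y) - g(X)).  In {poly {poly k}} the
   outer variable is X and the inner one is Y, so that f(Y) is f%:P and g(X) is
   g^:P. *)
Definition plane_model (f g : {poly k}) : Prop :=
  exists x y : F,
    let ev (p : {poly {poly k}}) : F :=
      (map_poly (map_poly iota) p).[x%:P].[y] in
    (forall p, ev p = 0 <-> exists r, p = r * (f%:P - map_poly polyC g)) /\
    (forall z : F, exists p q, ev q != 0 /\ z = ev p / ev q).

(* Normalised discrete valuations of F, trivial on k.  The value at 0, which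
   should be infinite, is set to 0, so that a place is determined by its
   values on nonzero functions. *)
Record place := Place {
  pval :> F -> int;
  pval0 : pval 0 = 0;
  pvalM : forall x y : F, x != 0 -> y != 0 -> pval (x * y) = pval x + pval y;
  pvalD : forall x y : F, x != 0 -> y != 0 -> x + y != 0 ->
    Num.min (pval x) (pval y) <= pval (x + y);
  pvalC : forall c : k, c != 0 -> pval (iota c) = 0;
  pval1 : exists t, t != 0 /\ pval t = 1
}.

HB.instance Definition _ := gen_eqMixin place.
HB.instance Definition _ := gen_choiceMixin place.

Definition local_ring (P : place) : set F := [set h | h = 0 \/ 0 <= P h].
Definition maximal_ideal (P : place) : set F := [set h | h = 0 \/ 0 < P h].

(* dim_k (V / W), for k-subspaces W of V of F; it is 0 by convention if V / W
   is not finite dimensional. *)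
Definition is_dim (V W : set F) (n : nat) : Prop :=
  exists u : 'I_n -> F, (forall i, V (u i)) /\
    forall z, V z ->
      exists! c : {ffun 'I_n -> k}, W (z - \sum_i iota (c i) * u i).
Definition dimk (V W : set F) : nat := xget 0%N [set n | is_dim V W n].

Definition pdeg (P : place) : nat := dimk (local_ring P) (maximal_ideal P).
Definition rational_place (P : place) : Prop := pdeg P = 1%N.

Local Notation divisor := {freeg place / int}.

Definition divisor_deg (D : divisor) : int :=
  \sum_(P <- dom D) coeff P D * (pdeg P)%:Z.

Definition linequiv (D E : divisor) : Prop :=
  exists h : F, h != 0 /\ forall P : place, coeff P (D - E) = P h.

Definition RRspace (D : divisor) : set F :=
  [set h | h = 0 \/ forall P : place, - coeff P D <= P h].
Definition ell (D : divisor) : nat := dimk (RRspace D) [set 0].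

(* The genus is the maximum of deg D - l(D) + 1 over all divisors D. *)
Definition is_genus (gen : nat) : Prop :=
  (forall D : divisor, divisor_deg D - (ell D)%:Z + 1 <= gen%:Z) /\
  (exists D : divisor, divisor_deg D - (ell D)%:Z + 1 = gen%:Z).

Section Semigroup.
Variables (m : nat) (Q : 'I_m -> place).

Definition regular_outside : set F :=
  [set h | forall P : place, (forall i, P <> Q i) -> local_ring P h].

Definition Hhat : set 'rV[int]_m :=
  [set al | exists h : F, [/\ regular_outside h, h != 0 &
                           al = \row_i (- (Q i : F -> int) h)]].

Definition nablaJ (J : {set 'I_m}) (al : 'rV[int]_m) : set 'rV[int]_m :=
  [set be | Hhat be /\ forall i, if i \in J then be 0 i = al 0 i
                                 else be 0 i < al 0 i].

Definition nabla (al : 'rV[int]_m) : set 'rV[int]_m :=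
  \bigcup_i nablaJ [set i]%SET al.

Definition relative_maximal (al : 'rV[int]_m) : Prop :=
  [/\ Hhat al, nabla al = set0 &
      forall J : {set 'I_m}, J \proper [set: 'I_m]%SET -> (2 <= #|J|)%N ->
        nablaJ J al !=set0].

Definition Lambdahat : set 'rV[int]_m := [set al | relative_maximal al].

End Semigroup.
End FunctionField.

(* The coordinates 1, ..., m of the tuples are indexed by 0, ..., m - 1. *)
Definition beta (a b m i : nat) : 'rV[int]_m :=
  \row_(j < m)
    if i == 0%N then (if j == 0%N :> nat then b%:Z * (m%:Z - 2) else 0)
    else (if j == 0%N :> nat then a%:Z * (b%:Z - i%:Z) - b%:Z else i%:Z).

Definition Cset (b m : nat) : set 'rV[int]_m :=
  [set be | forall j : 'I_m, j != 0%N :> nat -> 0 <= be 0 j < b%:Z].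
Arguments Cset : clear implicits.

(* Main.v *)
(* Let z and w_j have divisors P_2 + ... + P_(a+1) - a P_1 and b P_j - b P_1.  The
   genus forces the pole orders at P_1 of the functions regular elsewhere to be
   exactly the elements of <a, b>, so such a function has the pole order and the
   order at P_j of monomials z^i w_j^l with i < b; in particular, order b - 1 at
   P_j implies pole order at least a (b - 1) at P_1.  Multiplying by z^(i-1) w_j,
   one gets that a function with poles only at P_1, ..., P_m, of order i at P_j
   and less than i at the other P_l, has pole order at least a (b - i) - b at P_1.
   The functions z^(b-i) (sum_j c_j / w_j) show that this is sharp, which gives
   both the maximality of beta^i and the constraints on the other maximal elements.
   The element beta^0 is the translate of beta^b by the product of the w_j. *)

From HB Require Import structures.
Require Import Defs.
From mathcomp Require Import all_boot all_order all_algebra.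
From mathcomp Require Import boolp classical_sets.
From mathcomp Require Import freeg.
From mathcomp Require Import zify.

Set Implicit Arguments.
Unset Strict Implicit.
Unset Printing Implicit Defensive.
Import Order.TTheory GRing.Theory Num.Theory.
Local Open Scope classical_set_scope.
Local Open Scope ring_scope.

(** * Valuations *)

Section Valuation.
Variables (k F : fieldType) (iota : {rmorphism k -> F}).
Implicit Types (P Q : place iota) (x y h : F) (n : int).

Lemma pval_1 P : P 1 = 0.
Proof. by rewrite -(rmorph1 iota) pvalC ?oner_eq0. Qed.

Lemma pvalV P x : P x^-1 = - P x.
Proof.
have [->|x0] := eqVneq x 0; first by rewrite invr0 pval0 oppr0.
apply/eqP; rewrite -addr_eq0 -pvalM ?invr_eq0 //.
by rewrite mulVf // pval_1.
Qed.

Lemma pvalX P x i : x != 0 -> P (x ^+ i) = P x *+ i.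
Proof.
move=> x0; elim: i => [|i IH]; first by rewrite expr0 pval_1.
by rewrite exprS pvalM ?expf_neq0 // IH mulrS.
Qed.

Lemma pval_prod P (I : Type) (r : seq I) (A : pred I) (f : I -> F) :
  (forall i, f i != 0) ->
  P (\prod_(i <- r | A i) f i) = \sum_(i <- r | A i) P (f i).
Proof.
move=> f0; elim: r => [|i r IH]; first by rewrite !big_nil pval_1.
rewrite !big_cons; case: ifP => // _; rewrite pvalM ?IH //.
by elim/big_rec: _ => [|j y _ y0]; rewrite ?oner_eq0 ?mulf_neq0.
Qed.

Lemma pvalZ P c x : c != 0 -> P (iota c * x) = P x.
Proof.
have [->|x0] := eqVneq x 0; first by rewrite mulr0.
by move=> c0; rewrite pvalM ?fmorph_eq0 // pvalC // add0r.
Qed.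

Definition vge P n x := (x == 0) || (n <= P x).

Lemma vgeP P n x : x != 0 -> vge P n x = (n <= P x).
Proof. by rewrite /vge => /negbTE ->. Qed.

Lemma vge0 P n : vge P n 0.
Proof. by rewrite /vge eqxx. Qed.

Lemma vgeW P n n' x : n' <= n -> vge P n x -> vge P n' x.
Proof. by move=> nn' /orP[/eqP->|/(le_trans nn') nx]; rewrite /vge ?eqxx ?nx ?orbT. Qed.

Lemma vge_self P x : vge P (P x) x.
Proof. by rewrite /vge lexx orbT. Qed.

Lemma vgeD P n x y : vge P n x -> vge P n y -> vge P n (x + y).
Proof.
have [->|x0] := eqVneq x 0; first by rewrite add0r.
have [->|y0] := eqVneq y 0; first by rewrite addr0.
have [->|xy0] := eqVneq (x + y) 0; first by move=> *; rewrite vge0.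
rewrite !vgeP // => nx ny.
by apply: le_trans (pvalD P x0 y0 xy0); rewrite le_min nx.
Qed.

Lemma vgeM P n n' x y : vge P n x -> vge P n' y -> vge P (n + n') (x * y).
Proof.
have [->|x0] := eqVneq x 0; first by move=> *; rewrite mul0r vge0.
have [->|y0] := eqVneq y 0; first by move=> *; rewrite mulr0 vge0.
by rewrite !vgeP ?mulf_neq0 // pvalM // => *; rewrite lerD.
Qed.

Lemma vgeZ P n c x : vge P n x -> vge P n (iota c * x).
Proof.
have [->|c0] := eqVneq c 0; first by move=> *; rewrite rmorph0 mul0r vge0.
by rewrite /vge mulf_eq0 fmorph_eq0 (negPf c0) pvalZ.
Qed.

Lemma vgeN P n x : vge P n x -> vge P n (- x).
Proof. by rewrite -mulN1r -(rmorph1 iota) -rmorphN; apply: vgeZ. Qed.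

Lemma vgeB P n x y : vge P n x -> vge P n y -> vge P n (x - y).
Proof. by move=> nx ny; rewrite vgeD // vgeN. Qed.

Lemma vge_sum P n (I : Type) (r : seq I) (A : pred I) (f : I -> F) :
  (forall i, A i -> vge P n (f i)) -> vge P n (\sum_(i <- r | A i) f i).
Proof.
move=> nf; apply: (big_ind (fun x => vge P n x)) => //; first exact: vge0.
by move=> x y; apply: vgeD.
Qed.

(** If [x + y] had order above that of [x], so would [x = (x + y) - y]. *)
Lemma pval_add_lt P x y : x != 0 -> vge P (P x + 1) y ->
  x + y != 0 /\ P (x + y) = P x.
Proof.
move=> x0 xy.
have nge : ~~ vge P (P x + 1) (x + y).
  apply/negP => /vgeB/(_ xy); rewrite addrK vgeP //; lia.
have xy0 : x + y != 0 by apply: contraNneq nge => ->; rewrite vge0.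
split=> //; apply/eqP; rewrite eq_le; apply/andP; split.
  by move: nge; rewrite vgeP //; lia.
rewrite -(vgeP _ _ xy0) vgeD ?vge_self //; apply: vgeW xy; lia.
Qed.

End Valuation.

(** * Dimension over a finite field *)

Section Dimension.
Variables (k : finFieldType) (F : fieldType) (iota : {rmorphism k -> F}).
Implicit Types (V W : set F).

Definition lcomb n (c : {ffun 'I_n -> k}) (u : 'I_n -> F) :=
  \sum_i iota (c i) * u i.

Definition lfree n (u : 'I_n -> F) :=
  forall c : {ffun 'I_n -> k}, lcomb c u = 0 -> c = 0.

Definition ksubspace V :=
  V 0 /\ forall c x y, V x -> V y -> V (iota c * x + y).

(* For a subspace V, an injection into k^n exists iff dim V <= n, because k is
   finite. *)
Definition coded V n :=
  exists phi : F -> {ffun 'I_n -> k},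
    forall x y, V x -> V y -> phi x = phi y -> x = y.

Lemma lcombB n (c d : {ffun 'I_n -> k}) u :
  lcomb (c - d) u = lcomb c u - lcomb d u.
Proof.
rewrite -sumrB; apply: eq_bigr => i _.
by rewrite !ffunE rmorphB mulrBl.
Qed.

Lemma lcomb0 n (u : 'I_n -> F) : lcomb 0 u = 0.
Proof. by apply: big1 => i _; rewrite ffunE rmorph0 mul0r. Qed.

Lemma lcomb_mem V n (c : {ffun 'I_n -> k}) u :
  ksubspace V -> (forall i, V (u i)) -> V (lcomb c u).
Proof.
move=> [V0 VD] Vu; rewrite /lcomb.
by elim/big_rec: _ => // i x _ Vx; apply: VD.
Qed.

Lemma lfree_inj n (u : 'I_n -> F) c d : lfree u -> lcomb c u = lcomb d u -> c = d.
Proof.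
by move=> fu /eqP; rewrite -subr_eq0 -lcombB => /eqP/fu/eqP; rewrite subr_eq0 => /eqP.
Qed.

Lemma lfree_mul n (u : 'I_n -> F) w :
  w != 0 -> lfree u -> lfree (fun i => w * u i).
Proof.
move=> w0 fu c; have -> : lcomb c (fun i => w * u i) = w * lcomb c u.
  by rewrite mulr_sumr; apply: eq_bigr => i _; rewrite mulrCA.
by move/eqP; rewrite mulf_eq0 (negPf w0) => /eqP/fu.
Qed.

Lemma lfree_coded V n m (u : 'I_n -> F) :
  ksubspace V -> (forall i, V (u i)) -> lfree u -> coded V m -> (n <= m)%N.
Proof.
move=> sV Vu fu [phi phiI].
have : injective (fun c : {ffun 'I_n -> k} => phi (lcomb c u)).
  move=> c d /phiI E; apply: (lfree_inj fu); apply: E; exact: lcomb_mem.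
by move/leq_card; rewrite !card_ffun !card_ord leq_exp2l // card_finNzRing_gt1.
Qed.

Lemma coded_inj V W n (f : F -> F) :
  injective f -> (forall x, V x -> W (f x)) -> coded W n -> coded V n.
Proof.
move=> fI VW [phi phiI]; exists (phi \o f) => x y Vx Vy /= E.
by apply: fI; apply: phiI E; apply: VW.
Qed.

Lemma coded_mul V W n w :
  w != 0 -> (forall x, V x -> W (w * x)) -> coded W n -> coded V n.
Proof. by move=> w0; apply: coded_inj; apply: mulfI. Qed.

Lemma coded_leq V n m : (n <= m)%N -> coded V n -> coded V m.
Proof.
move=> nm [phi phiI].
exists (fun x => [ffun i : 'I_m => oapp (phi x) 0 (insub (val i))]).
move=> x y Vx Vy /ffunP E; apply: phiI => //; apply/ffunP => i.
have := E (widen_ord nm i); rewrite !ffunE /= insubT //= => li.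
by rewrite (_ : Sub _ _ = i) //; apply: val_inj; rewrite SubK.
Qed.

(** An element [x] is coded by [r x] and by the code in [W] of its difference with a chosen element
    of the same fibre of [r]. *)
Lemma coded_extend V W n d (r : F -> {ffun 'I_d -> k}) :
  ksubspace V -> (forall x y, V x -> V y -> r x = r y -> W (x - y)) ->
  coded W n -> coded V (n + d).
Proof.
move=> sV rW [phi phiI].
have /choice[rep repP] : forall c, exists z, forall x, V x -> r x = c ->
    V z /\ r z = c.
  move=> c; have [[z [Vz rz]]|nz] := pselect (exists z, V z /\ r z = c).
    by exists z.
  by exists 0 => x Vx rx; case: nz; exists x.
exists (fun x => [ffun i => match split i with
   | inl j => phi (x - rep (r x)) j | inr j => r x j end]) => x y Vx Vy /ffunP E.
have rE : r x = r y.
  apply/ffunP => j; have := E (unsplit (inr j)); by rewrite !ffunE unsplitK.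
have pE : phi (x - rep (r x)) = phi (y - rep (r y)).
  apply/ffunP => j; have := E (unsplit (inl j)); by rewrite !ffunE unsplitK.
have [Vz rz] := repP _ x Vx erefl.
apply: (addIr (- rep (r x))).
by rewrite [in RHS]rE; apply: phiI pE; apply: rW; rewrite // -?rE // rz.
Qed.

Lemma is_dim_lfree V n : ksubspace V -> is_dim iota V [set 0] n ->
  exists u : 'I_n -> F, (forall i, V (u i)) /\ lfree u.
Proof.
move=> [V0 _] [u [Vu uU]]; exists u; split=> // c cu.
have [d [_ dU]] := uU _ V0.
have W0 (e : {ffun 'I_n -> k}) : lcomb e u = 0 -> d = e.
  by move=> e0; apply: dU; rewrite -/(lcomb e u) e0 subr0.
by rewrite -(W0 _ cu); apply: W0; apply: lcomb0.
Qed.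

Lemma is_dim_coded V n : is_dim iota V [set 0] n -> coded V n.
Proof.
move=> [u [Vu uU]].
have /choice[phi phiP] : forall z, exists c, V z -> z = lcomb c u.
  move=> z; have [Vz|nVz] := pselect (V z); last by exists 0.
  by have [c [/= /eqP + _]] := uU _ Vz; rewrite subr_eq0 => /eqP; exists c.
by exists phi => x y Vx Vy E; rewrite (phiP _ Vx) (phiP _ Vy) E.
Qed.

(** The code bounds the length of free families in [V]; one of maximal length is a basis. *)
Lemma coded_is_dim V N : ksubspace V -> coded V N ->
  exists n, is_dim iota V [set 0] n.
Proof.
move=> sV cV.
pose A n := `[< exists u : 'I_n -> F, (forall i, V (u i)) /\ lfree u >].
have A0 : exists n, A n.
  exists 0%N; apply/asboolP; exists (fun=> 0).
  by split=> [[]//|c _]; apply/ffunP => -[].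
have AN n : A n -> (n <= N)%N.
  by move/asboolP => [u [Vu fu]]; apply: lfree_coded cV.
case: (ex_maxnP A0 AN) => n /asboolP[u [Vu fu]] nmax.
exists n, u; split=> // z Vz.
suff [c zc] : exists c, z = lcomb c u.
  exists c; split=> [|d /= /eqP].
    by apply/eqP; rewrite subr_eq0; apply/eqP.
  by rewrite subr_eq0 => /eqP zd; apply: (lfree_inj fu); rewrite -zc.
(* [v] puts [z] in front of [u]. By maximality it is not free, and a relation must involve [z]
   because [u] is free. *)
pose v (i : 'I_n.+1) := oapp u z (unlift ord0 i).
have nfv : ~ lfree v.
  move=> fv; suff : (n.+1 <= n)%N by rewrite ltnn.
  apply: nmax; apply/asboolP; exists v; split=> // i.
  by rewrite /v; case: unliftP => [j|] _ /=.
apply: contrapT => nz; apply: nfv => c.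
have -> : lcomb c v = iota (c ord0) * z + lcomb [ffun i : 'I_n => c (fintype.lift ord0 i)] u.
  rewrite /lcomb big_ord_recl /v unlift_none /=; congr (_ + _).
  by apply: eq_bigr => i _; rewrite liftK ffunE.
have [c0|c0] := eqVneq (c ord0) 0.
  rewrite c0 rmorph0 mul0r add0r => /fu/ffunP cE; apply/ffunP => i; rewrite ffunE.
  by case: (unliftP ord0 i) => [j ->|->//]; have := cE j; rewrite !ffunE.
move=> /eqP; rewrite addr_eq0 => /eqP E; case: nz.
exists [ffun i : 'I_n => - (c ord0)^-1 * c (fintype.lift ord0 i)].
apply: (@mulfI _ (iota (c ord0))); rewrite ?fmorph_eq0 // E.
rewrite mulr_sumr -sumrN; apply: eq_bigr => i _; rewrite !ffunE.
rewrite mulrA -rmorphM mulrA mulrN mulfV // mulN1r rmorphN mulNr //.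
Qed.

(** The term of least valuation among those with nonzero coefficient cannot be cancelled by the
    others. *)
Lemma lfree_distinct_pval (P : place iota) n (u : 'I_n -> F) :
  (forall i, u i != 0) -> injective (fun i => P (u i)) -> lfree u.
Proof.
move=> u0 uI c cu; apply/eqP/negPn/negP => c0.
have [j cj] : exists j, c j != 0.
  apply: contrapT => nj; case/eqP: c0; apply/ffunP => i; rewrite ffunE.
  by apply/eqP/negPn/negP => ci; apply: nj; exists i.
case: (@arg_minP _ _ _ j (fun i => c i != 0) (fun i => P (u i)) cj) => i ci imin.
have iu0 : iota (c i) * u i != 0 by rewrite mulf_neq0 ?fmorph_eq0.
move: cu; rewrite /lcomb (bigD1 i) //= => E.
have /(pval_add_lt iu0)[] : vge P (P (iota (c i) * u i) + 1)
    (\sum_(i0 < n | i0 != i) iota (c i0) * u i0); last by rewrite E eqxx.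
apply: vge_sum => l li; have [->|cl] := eqVneq (c l) 0.
  by rewrite rmorph0 mul0r vge0.
rewrite vgeP ?mulf_neq0 ?fmorph_eq0 // !pvalZ //.
have := imin _ cl; rewrite le_eqVlt => /orP[/eqP/uI E'|].
  by rewrite E' eqxx in li.
by lia.
Qed.

End Dimension.

(** * Divisors and Riemann-Roch spaces *)

Section Divisors.
Variables (k F : fieldType) (iota : {rmorphism k -> F}).
Local Notation divisor := {freeg (place iota) / int}.
Implicit Types (D E B : divisor) (P Q : place iota) (x y h : F).

Lemma RRspaceP D x : RRspace D x <-> forall P, vge P (- coeff P D) x.
Proof.
split=> [[->|Dx] P|]; first exact: vge0.
  by rewrite /vge Dx orbT.
have [->|x0] := eqVneq x 0; first by left.
by move=> Dx; right=> P; rewrite -(vgeP P _ x0).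
Qed.

HB.instance Definition _ (K : choiceType) (M : lmodType int) (u : K -> M) :=
  GRing.isZmodMorphism.Build {freeg K / int} M (fglift u) (lift_is_additive u).

Lemma divisor_degE D :
  divisor_deg D = fglift (fun P => (pdeg P)%:Z : int^o) D.
Proof.
rewrite -[D in RHS]freeg_sumE raddf_sum; apply: eq_bigr => P _ /=.
by rewrite liftU.
Qed.

Lemma divisor_degB D E : divisor_deg (D - E) = divisor_deg D - divisor_deg E.
Proof. by rewrite !divisor_degE raddfB. Qed.

Lemma divisor_degMn D n : divisor_deg (D *+ n) = divisor_deg D *+ n.
Proof. by rewrite !divisor_degE raddfMn. Qed.

Lemma divisor_degU P : divisor_deg (<< P >> : divisor) = (pdeg P)%:Z.
Proof. by rewrite divisor_degE liftU scale1r. Qed.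

Lemma divisor_deg_sum (s : seq (place iota)) :
  divisor_deg (\sum_(Q <- s) << Q >> : divisor) = (\sum_(Q <- s) pdeg Q)%N%:Z.
Proof.
rewrite divisor_degE raddf_sum /= (raddf_sum Posz).
by apply: eq_bigr => Q _ /=; rewrite liftU scale1r.
Qed.

Lemma pval_surj P (n : int) : exists t, t != 0 /\ P t = n.
Proof.
have [t [t0 t1]] := pval1 P; case: n => n.
  by exists (t ^+ n); rewrite expf_neq0 // pvalX // t1 natz.
exists (t ^+ n.+1)^-1; rewrite invr_neq0 ?expf_neq0 // pvalV pvalX // t1 natz.
by split=> //; lia.
Qed.

Lemma coeff1 P Q : coeff P (<< Q >> : divisor) = (Q == P)%:R.
Proof. by rewrite coeffU mul1r. Qed.

End Divisors.

(** * Consequences of the genus bound over a finite field *)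

Section RiemannRoch.
Variables (k : finFieldType) (F : fieldType) (iota : {rmorphism k -> F}).
Local Notation divisor := {freeg (place iota) / int}.
Implicit Types (D E B : divisor) (P Q : place iota) (x y h : F).

Lemma RR_ksubspace D : ksubspace iota (RRspace D).
Proof.
split=> [|c x y]; first by left.
by move=> /RRspaceP xD /RRspaceP yD; apply/RRspaceP => P; rewrite vgeD ?vgeZ.
Qed.

Lemma lfree_neq0 n (u : 'I_n -> F) i : lfree iota u -> u i != 0.
Proof.
move=> fu; apply/eqP => ui.
have /ffunP/(_ i) : [ffun j => (j == i)%:R : k] = 0.
  apply: fu; apply: big1 => j _; rewrite ffunE.
  by have [->|_] := eqVneq j i; rewrite ?ui ?mulr0 // rmorph0 mul0r.
by rewrite !ffunE eqxx => /eqP; rewrite oner_eq0.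
Qed.

(** [ell] is 0 by default when no dimension exists, so a positive value certifies one. *)
Lemma ell_is_dim D : (0 < ell D)%N -> is_dim iota (RRspace D) [set 0] (ell D).
Proof. by rewrite /ell /dimk; case: xgetP. Qed.

(** Division by [t], whose order at [Q] is the least one allowed in L(E + Q), sends L(E + Q) into
    the local ring; two elements with the same residue then differ by an element of L(E). *)
Lemma RR_coded_extend E Q n : is_dim iota (local_ring Q) (maximal_ideal Q) (pdeg Q) ->
  coded k (RRspace E) n -> coded k (RRspace (E + << Q >>)) (n + pdeg Q).
Proof.
move=> [u [_ uU]].
have [t [t0 Qt]] := pval_surj Q (- coeff Q E - 1).
have /choice[rho rhoP] : forall z, exists c, local_ring Q z ->
    maximal_ideal Q (z - lcomb iota c u).
  move=> z; have [Oz|nOz] := pselect (local_ring Q z); last by exists 0.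
  by have [c [mc _]] := uU _ Oz; exists c.
apply: (@coded_extend _ _ iota _ _ _ _ (fun x => rho (x / t))) => [|x y].
  exact: RR_ksubspace.
move=> xE yE rE; apply/RRspaceP => P.
move: (xE) (yE) => /RRspaceP xP /RRspaceP yP.
have [<-|PQ] := eqVneq Q P; last first.
  have := vgeB (xP P) (yP P); rewrite coeffD coeff1.
  by rewrite (negPf PQ) addr0.
have Ot z : RRspace (E + << Q >>) z -> local_ring Q (z / t).
  move=> /RRspaceP/(_ Q) /vgeM/(_ (vge_self Q t^-1)).
  rewrite coeffD coeff1 eqxx pvalV Qt.
  by case/orP => [/eqP|zt]; [left | right; lia].
have Em z : maximal_ideal Q z -> vge Q 1 z.
  by case=> [->|z0]; [apply: vge0 | apply/orP; right; lia].
have := vgeB (Em _ (rhoP _ (Ot _ xE))) (Em _ (rhoP _ (Ot _ yE))).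
rewrite rE opprB addrA subrK -mulrBl => /vgeM/(_ (vge_self Q t)).
by rewrite divfK // Qt; apply: vgeW; lia.
Qed.

Variables (gen : nat) (hgen : is_genus iota gen).
Variables (P0 : place iota) (P0_rat : rational_place P0).

Lemma RR_neq0 D : gen%:Z <= divisor_deg D -> exists2 x, x != 0 & RRspace D x.
Proof.
case: hgen => /(_ D) gD _ Dg.
have e0 : (0 < ell D)%N by lia.
have [u [Du fu]] := is_dim_lfree (RR_ksubspace D) (ell_is_dim e0).
by exists (u (Ordinal e0)) => //; apply: lfree_neq0.
Qed.

Lemma deg_nP0 n : divisor_deg (<< P0 >> *+ n : divisor) = n%:Z.
Proof. by rewrite divisor_degMn divisor_degU P0_rat natz. Qed.

Lemma ell_nP0 n : (n < ell (<< P0 >> *+ n : divisor) + gen)%N.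
Proof. by case: hgen => /(_ (<< P0 >> *+ n)); rewrite deg_nP0; lia. Qed.

(** A nonzero [w] in L(N P0 - D) embeds L(D) into L(N P0), whose [ell] is positive by the genus
    bound, hence a genuine dimension. *)
Lemma RR_coded D : exists N, coded k (RRspace D) N.
Proof.
pose N := (gen + `|divisor_deg D|)%N.
have [|w w0 /RRspaceP wD] := @RR_neq0 (<< P0 >> *+ N - D).
  by rewrite divisor_degB deg_nP0; lia.
exists (ell (<< P0 >> *+ N : divisor)).
apply: (@coded_mul _ _ _ (RRspace (<< P0 >> *+ N : divisor)) _ w) => //.
  move=> x /RRspaceP xD; apply/RRspaceP => P.
  by have := vgeM (wD P) (xD P); rewrite coeffB opprB addrAC subrr add0r.
apply: (is_dim_coded (ell_is_dim _)); have := ell_nP0 N; lia.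
Qed.

Lemma RR_dim D : is_dim iota (RRspace D) [set 0] (ell D).
Proof.
have [N /(coded_is_dim (RR_ksubspace D))] := RR_coded D.
by rewrite /ell /dimk => /xgetPex; apply.
Qed.

(* If the degree of Q were infinite, it would be 0 by convention, and the spaces
   L(gen P0 - s Q) would be nonzero for all s, inside a finite set. *)
Lemma pdeg_gt0 Q : (0 < pdeg Q)%N.
Proof.
have [->|QP] := eqVneq Q P0; first by rewrite P0_rat.
rewrite lt0n; apply/eqP => dQ.
pose D s : divisor := << P0 >> *+ gen - << Q >> *+ s.
have /choice[x xP] : forall s, exists x, x != 0 /\ RRspace (D s) x.
  move=> s; have [|x x0 Dx] := @RR_neq0 (D s); last by exists x.
  by rewrite divisor_degB deg_nP0 divisor_degMn divisor_degU dQ mul0rn subr0.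
have coefD s P : coeff P (D s) = (P0 == P)%:R *+ gen - (Q == P)%:R *+ s.
  by rewrite coeffB !coeffMn !coeff1.
have [N [phi phiI]] := RR_coded (<< P0 >> *+ gen).
have xV s : RRspace (<< P0 >> *+ gen) (x s).
  have [_ /RRspaceP xs] := xP s; apply/RRspaceP => P; apply: vgeW (xs P).
  rewrite coefD coeffMn coeff1; case: eqVneq; case: eqVneq => *; lia.
have xQ s : s%:Z <= Q (x s).
  have [x0 /RRspaceP/(_ Q)] := xP s; rewrite vgeP // coefD eqxx.
  by rewrite eq_sym (negPf QP) mul0rn add0r opprK natz.
(* The order of [x s] at [Q] is a function of its code, so it takes finitely many values, whereas
   [xQ] makes it grow with [s]. *)
pose bound (c : {ffun 'I_N -> k}) : nat :=
  xget 0%N [set n | exists2 s, phi (x s) = c & n = `|Q (x s)|%N].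
have boundP s : `|Q (x s)|%N = bound (phi (x s)).
  rewrite /bound; case: xgetP => [n _ [s' E ->]|/(_ `|Q (x s)|%N) []].
    by rewrite (phiI _ _ (xV _) (xV _) E).
  by exists s.
pose s := (\sum_c bound c).+1.
have : (`|Q (x s)| <= \sum_c bound c)%N.
  by rewrite boundP (bigD1 (phi (x s))) //= leq_addr.
have := xQ s; rewrite /s; lia.
Qed.

Lemma residue_dim Q : is_dim iota (local_ring Q) (maximal_ideal Q) (pdeg Q).
Proof. by move: (pdeg_gt0 Q); rewrite /pdeg /dimk; case: xgetP. Qed.

Lemma RR_coded_extend_seq E (s : seq (place iota)) n : coded k (RRspace E) n ->
  coded k (RRspace (E + \sum_(Q <- s) << Q >>)) (n + \sum_(Q <- s) pdeg Q).
Proof.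
move=> En; elim: s => [|Q s IH]; first by rewrite !big_nil addr0 addn0.
rewrite !big_cons addrCA addrC [X in (n + X)%N]addnC addnA.
by apply: RR_coded_extend; first exact: residue_dim.
Qed.

(* L(s B) embeds into L(0) through multiplication by h^s, so the genus bounds
   s deg B independently of s. *)
Lemma deg_le0 B h : h != 0 -> (forall Q, coeff Q B <= Q h) -> divisor_deg B <= 0.
Proof.
move=> h0 Bh; rewrite leNgt; apply/negP => B0.
(* As deg B >= 1, the genus bound for s B gives ell(s B) > ell(0) with this [s]. *)
pose s := (ell (0%R : divisor) + gen)%N.
have [u [uB fu]] := is_dim_lfree (RR_ksubspace _) (RR_dim (B *+ s)).
suff : (ell (B *+ s) <= ell (0%R : divisor))%N.
  case: hgen => /(_ (B *+ s)) + _; rewrite divisor_degMn -mulr_natr natz.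
  rewrite /s; nia.
apply: (lfree_coded (RR_ksubspace 0) _ (lfree_mul (expf_neq0 s h0) fu)).
  move=> i; apply/RRspaceP => Q; have /RRspaceP/(_ Q) := uB i.
  move/(vgeM (vge_self Q (h ^+ s))); apply: vgeW.
  rewrite coeff0 coeffMn pvalX // oppr0 -mulrnBl; apply: mulrn_wge0.
  by rewrite subr_ge0.
exact: is_dim_coded (RR_dim 0).
Qed.

(* If D attains the genus and h lies in L(n P0 - D), then h identifies L(D) with
   L(n P0 - A) for some effective A of degree at most n - deg D. *)
Lemma RR_nP0_coded : exists n0, forall n, (n0 <= n)%N ->
  coded k (RRspace (<< P0 >> *+ n)) (n.+1 - gen).
Proof.
have [_ [D Dg]] := hgen.
exists (gen + `|divisor_deg D|)%N => n n0.
pose D' : divisor := << P0 >> *+ n - D.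
have D'deg : divisor_deg D' = n%:Z - divisor_deg D by rewrite divisor_degB deg_nP0.
have [|h h0 hD'] := @RR_neq0 D'; first by rewrite D'deg; lia.
(* A sequence of places of maximal length below div h + D' is equal to it: degrees bound the length
   because [pdeg] is positive, and any place left over could be added. *)
pose A r := `[< exists2 s : seq (place iota), size s = r &
  forall Q, coeff Q (\sum_(P <- s) << P >> - D') <= Q h >].
have A0 : exists r, A r.
  exists 0%N; apply/asboolP; exists [::] => // Q.
  by rewrite big_nil sub0r coeffN; case: hD' => [/eqP|//]; rewrite (negPf h0).
have sdeg (s : seq (place iota)) :
    (forall Q, coeff Q (\sum_(P <- s) << P >> - D') <= Q h) ->
    (\sum_(Q <- s) pdeg Q)%N%:Z <= divisor_deg D'.
  by move/(deg_le0 h0); rewrite divisor_degB divisor_deg_sum subr_le0.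
have AN r : A r -> (r <= `|divisor_deg D'|)%N.
  move/asboolP => [s <- /sdeg].
  have : (size s <= \sum_(Q <- s) pdeg Q)%N.
    by rewrite -sum1_size; apply: leq_sum => Q _; apply: pdeg_gt0.
  lia.
case: (ex_maxnP A0 AN) => r /asboolP[s sr sh] rmax.
have {rmax} hE Q : Q h = coeff Q (\sum_(P <- s) << P >> - D').
  apply/eqP; rewrite eq_le sh andbT leNgt; apply/negP => hQ.
  suff /rmax : A r.+1 by rewrite ltnn.
  apply/asboolP; exists (Q :: s) => [|P]; first by rewrite /= sr.
  rewrite big_cons -addrA coeffD coeff1; have := sh P.
  by have [<- _|_] := eqVneq Q P; [move: hQ; rewrite -lezD1 [_ + 1]addrC | rewrite add0r].
(* [E] is D - div h. Adding the places of [s] back leads to L(n P0) at a cost of at most deg D', and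
   ell D + deg D' = n + 1 - gen. *)
pose E : divisor := << P0 >> *+ n - \sum_(P <- s) << P >>.
have En : coded k (RRspace E) (ell D).
  apply: (@coded_mul _ _ _ (RRspace D) _ h^-1); rewrite ?invr_neq0 //.
    move=> x /RRspaceP xE; apply/RRspaceP => P.
    have := vgeM (vge_self P h^-1) (xE P); rewrite pvalV hE -opprD.
    by rewrite -coeffD addrC /E /D' opprB addrA subrK addrC subrK.
  exact: is_dim_coded (RR_dim D).
have := RR_coded_extend_seq s En; rewrite subrK.
by apply: coded_leq; have := sdeg _ sh; lia.
Qed.

End RiemannRoch.

(** * Pole orders *)

Section NumericalSemigroup.
Variables (a b : nat).
Hypotheses (a0 : (0 < a)%N) (b0 : (0 < b)%N) (cab : coprime a b).

Definition representable (t : nat) := `[< exists i l, t = (a * i + b * l)%N >].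

(** A multiple of a Bezout relation, with the coefficient of [a] reduced modulo [b]. *)
Lemma int_repr (t : int) : exists i (l : int), (i < b)%N /\ t = a%:Z * i%:Z + b%:Z * l.
Proof.
have [u [v]] := Bezoutz a b; rewrite /gcdz /= (eqP cab) => uv.
have b0' : b%:Z != 0 by lia.
have tb := divz_eq (t * u) b%:Z.
have m0 := modz_ge0 (t * u) b0'.
have mb := ltz_pmod (t * u) (_ : 0 < b%:Z).
exists `|((t * u) %% b%:Z)%Z|%N, (t * v + ((t * u) %/ b%:Z)%Z * a%:Z).
split; first by lia.
rewrite gez0_abs //.
by have : t = t * (u * a%:Z + v * b%:Z); [rewrite uv mulr1 | nia].
Qed.

Lemma reprP t : reflect (exists i l, (i < b)%N /\ t = (a * i + b * l)%N) (representable t).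
Proof.
apply: (iffP (asboolP _)) => [[i [l ->]]|[i [l [_ ->]]]]; last by exists i, l.
exists (i %% b)%N, (l + a * (i %/ b))%N; rewrite ltn_mod; split=> //.
by rewrite {1}(divn_eq i b); lia.
Qed.

(** This concerns the Frobenius number a b - a - b. By coprimality [b] would divide i + 1, so that a
    (i + 1) alone reaches a b. *)
Lemma Frobenius_not_repr i l : (a * i + b * l + a + b <> a * b)%N.
Proof.
move=> E; have bi : (b %| i.+1)%N.
  rewrite -(Gauss_dvdr _ (_ : coprime b a)) 1?coprime_sym //.
  rewrite -(dvdn_addl _ (dvdn_mulr l.+1 (dvdnn b))).
  by rewrite (_ : _ + _ = a * b)%N ?dvdn_mull // -E; lia.
by have := dvdn_leq (ltn0Sn i) bi; nia.
Qed.

(** Write t = a i + b l with 0 <= i < b. Then l < 0, and (a - 1)(b - 1) - 1 - t = a (b - 1 - i) + b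
    (-l - 1). *)
Lemma not_repr_sym t : ~~ representable t ->
  (t < a.-1 * b.-1)%N /\ representable ((a.-1 * b.-1).-1 - t).
Proof.
move=> nt; have [i [l [ib E]]] := int_repr t.
have l0 : l < 0.
  rewrite ltNge; apply: contra nt => l0; apply/reprP; exists i, `|l|%N.
  by split=> //; lia.
have E' : (t + a * (b.-1 - i) + b * `|l|.-1 + a + b = a * b)%N by nia.
have EN : (a.-1 * b.-1 + a + b = (a * b).+1)%N by nia.
have tE : ((a.-1 * b.-1).-1 - t = a * (b.-1 - i) + b * `|l|.-1)%N.
  move: E' EN; move: (a * (b.-1 - i))%N (b * `|l|.-1)%N => X Y.
  by move: (a * b)%N (a.-1 * b.-1)%N => Z W; lia.
split; last by apply/asboolP; exists (b.-1 - i)%N, `|l|.-1.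
move: E' EN; move: (a * (b.-1 - i))%N (b * `|l|.-1)%N => X Y.
by move: (a * b)%N (a.-1 * b.-1)%N => Z W; lia.
Qed.

(** The reflection of [0, N) sends gaps to elements of the semigroup, so gaps fill at most half of
    this interval; there are none beyond it. *)
Lemma count_not_repr n : (\sum_(t < n) ~~ representable t <= (a.-1 * b.-1) %/ 2)%N.
Proof.
set N := (a.-1 * b.-1)%N.
have gap t : (N <= t)%N -> representable t.
  by move=> Nt; apply/negPn/negP => /not_repr_sym[]; rewrite ltnNge Nt.
apply: (@leq_trans (\sum_(t < N) ~~ representable t)).
  rewrite -!(big_mkord xpredT (fun t => ~~ representable t : nat)).
  have [nN|/ltnW Nn] := leqP n N.
    by rewrite (@big_cat_nat _ _ _ n 0 N) //= leq_addr.
  rewrite (@big_cat_nat _ _ _ N 0 n) //= [X in (_ + X <= _)%N]big_nat_cond.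
  rewrite [X in (_ + X <= _)%N]big1 ?addn0 // => t /andP[/andP[/gap -> //]].
rewrite leq_divRL // muln2 -addnn {1}(reindex_inj rev_ord_inj) /= -big_split /=.
rewrite -[X in (_ <= X)%N]card_ord -sum1_card; apply: leq_sum => t _.
have [rt|/not_repr_sym[_]] := boolP (representable t); first by rewrite addn0 leq_b1.
by rewrite (_ : N - t.+1 = N.-1 - t)%N => [->|] //; lia.
Qed.

Lemma card_repr n : (n - (a.-1 * b.-1) %/ 2 <= #|[set t : 'I_n | representable t]%SET|)%N.
Proof.
have E : (#|[set t : 'I_n | representable t]%SET| + \sum_(t < n) ~~ representable t = n)%N.
  rewrite -sum1dep_card big_mkcond -big_split /= -[RHS]card_ord -sum1_card.
  by apply: eq_bigr => t _; case: ifP.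
have := count_not_repr n; lia.
Qed.

End NumericalSemigroup.

Lemma int_mulrn (x : int) n : x *+ n = x * n%:Z.
Proof. by rewrite -mulr_natr natz. Qed.

(** At a rational place the residue of [x / y] is a constant. *)
Lemma rational_leading_coef (k F : fieldType) (iota : {rmorphism k -> F})
    (P : place iota) (x y : F) : rational_place P -> x != 0 -> y != 0 -> P x = P y ->
  exists2 c, c != 0 & vge P (P x + 1) (x - iota c * y).
Proof.
move=> Prat x0 y0 xy.
have [u [_ uU]] : is_dim iota (local_ring P) (maximal_ideal P) 1.
  by rewrite -[X in is_dim _ _ _ X]Prat; move: Prat; rewrite /rational_place /pdeg /dimk; case: xgetP.
have mP w : maximal_ideal P w -> vge P 1 w.
  by case=> [->|w0]; [apply: vge0 | apply/orP; right; lia].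
have Pw : P (x / y) = 0 by rewrite pvalM ?invr_neq0 // pvalV xy subrr.
have [|c [/mP + _]] := uU (x / y); first by right; rewrite Pw.
(* The basis element given by [is_dim] need not be 1; the coordinate of 1 corrects the scale, and
   the constant is [c0 / d0]. *)
have [|d [/mP + _]] := uU 1; first by right; rewrite pval_1.
rewrite !big_ord1; set c0 := c _; set d0 := d _ => dP cP.
have d00 : d0 != 0.
  by apply: contraTneq dP => ->; rewrite rmorph0 mul0r subr0 vgeP ?oner_eq0 // pval_1.
have E : vge P 1 (x / y - iota (c0 / d0)).
  have := vgeB cP (vgeZ (c0 / d0) dP).
  by rewrite mulrBr mulr1 mulrA -rmorphM divfK // opprB addrA subrK.
exists (c0 / d0).
  apply: contraTneq E => ->.
  by rewrite rmorph0 subr0 vgeP ?mulf_neq0 ?invr_neq0 // Pw.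
have := vgeM E (vge_self P y).
by rewrite mulrBl divfK // xy addrC.
Qed.

(** * Pole orders at [P0] of the functions regular elsewhere *)

Section PoleOrders.
Variables (k : finFieldType) (F : fieldType) (iota : {rmorphism k -> F}).
Variables (a b gen : nat) (hgen : is_genus iota gen).
Hypotheses (a0 : (0 < a)%N) (b0 : (0 < b)%N) (cab : coprime a b).
Hypothesis genE : gen = (a.-1 * b.-1 %/ 2)%N.
Variables (P0 : place iota) (P0_rat : rational_place P0).
Variables (z f : F).
Hypotheses (z0 : z != 0) (f0 : f != 0).
Hypotheses (P0z : P0 z = - a%:Z) (P0f : P0 f = - b%:Z).

Definition reg (h : F) := forall Q, Q <> P0 -> vge Q 0 h.

Hypotheses (zreg : reg z) (freg : reg f).

Lemma regM x y : reg x -> reg y -> reg (x * y).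
Proof. by move=> xr yr Q QP; rewrite -[0]addr0; apply: vgeM; [apply: xr|apply: yr]. Qed.

Lemma regX x i : reg x -> reg (x ^+ i).
Proof.
move=> xr; elim: i => [|i IH]; last by rewrite exprS; apply: regM.
by move=> Q _; rewrite expr0 vgeP ?oner_eq0 // pval_1.
Qed.

Lemma monomial_neq0 i l : z ^+ i * f ^+ l != 0.
Proof. by rewrite mulf_neq0 ?expf_neq0. Qed.

Lemma monomial_reg i l : reg (z ^+ i * f ^+ l).
Proof. by apply: regM; apply: regX. Qed.

Lemma pval_monomial (Q : place iota) i l : Q (z ^+ i * f ^+ l) = Q z *+ i + Q f *+ l.
Proof. by rewrite pvalM ?expf_neq0 // !pvalX. Qed.

Lemma P0_monomial i l : P0 (z ^+ i * f ^+ l) = - (a * i + b * l)%N%:Z.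
Proof. by rewrite pval_monomial P0z P0f !int_mulrn; lia. Qed.

(** A zero at [P0] and no pole would put [P0], of degree 1, below the divisor of [h]. *)
Lemma pole_ge0 h : h != 0 -> reg h -> P0 h <= 0.
Proof.
move=> h0 hr; rewrite leNgt; apply/negP => Ph.
have : divisor_deg (<< P0 >> : {freeg (place iota) / int}) <= 0.
  apply: (deg_le0 hgen P0_rat h0) => Q; rewrite coeff1.
  have [<-|PQ] := eqVneq P0 Q; first by lia.
  by rewrite -vgeP //; apply: hr => E; rewrite E eqxx in PQ.
by rewrite divisor_degU P0_rat.
Qed.

(* A pole order outside the semigroup generated by a and b would give too many
   functions with distinct pole orders in L(n P0) for n large. *)
Lemma pole_repr h : h != 0 -> reg h ->
  exists i l, (i < b)%N /\ P0 h = - (a * i + b * l)%N%:Z.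
Proof.
move=> h0 hr; have Ph := pole_ge0 h0 hr; pose s := `|P0 h|%N.
suff /(reprP a0 b0 cab)[i [l [ib E]]] : representable a b s by exists i, l; split=> //; lia.
apply/negPn/negP => ns.
have [n0 /(_ (n0 + s)%N (leq_addr _ _)) En] := RR_nP0_coded hgen P0_rat.
set n := (n0 + s)%N in En.
(* If [s] is not representable, [T] has one element more than the semigroup has up to n, hence more
   than n + 1 - gen. *)
pose T := [set t : 'I_n.+1 | representable a b t || (t == s :> nat)]%SET.
have /choice[x xP] : forall t : nat, exists x, representable a b t || (t == s) ->
    [/\ x != 0, reg x & P0 x = - t%:Z].
  move=> t; have [/asboolP[i [l E]]|_] := boolP (representable a b t).
    exists (z ^+ i * f ^+ l) => _; rewrite monomial_neq0 P0_monomial E.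
    by split=> //; apply: monomial_reg.
  by exists h => /= /eqP ->; split=> //; lia.
have xT (i : 'I_#|T|) : [/\ x (enum_val i) != 0, reg (x (enum_val i))
    & P0 (x (enum_val i)) = - (enum_val i : nat)%:Z].
  by apply: xP; have := enum_valP i; rewrite inE.
have : (#|T| <= n.+1 - gen)%N.
  apply: (lfree_coded (RR_ksubspace _) _ _ En (u := fun i : 'I_#|T| => x (enum_val i))).
    move=> i; have [xi0 xr xP0] := xT i; apply/RRspaceP => Q; rewrite coeffMn coeff1.
    have [<-|PQ] := eqVneq P0 Q.
      by rewrite vgeP // xP0; have := ltn_ord (enum_val i); lia.
    by rewrite mul0rn oppr0; apply: xr => E; rewrite E eqxx in PQ.
  apply: (@lfree_distinct_pval _ _ _ P0) => [i|i j]; first by case: (xT i).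
  have [_ _ ->] := xT i; have [_ _ ->] := xT j => /oppr_inj[] /val_inj.
  exact: enum_val_inj.
have sn : (s < n.+1)%N by rewrite ltnS leq_addl.
have -> : T = (Ordinal sn |: [set t : 'I_n.+1 | representable a b t])%SET.
  by apply/setP => t; rewrite !inE orbC -val_eqE.
rewrite cardsU1 inE /= ns; have := card_repr a0 b0 cab n.+1; rewrite -genE.
by rewrite add1n => /leq_ltn_trans/[apply]; rewrite ltnn.
Qed.

Lemma pole_order_neq_Frobenius h : h != 0 -> reg h ->
  P0 h <> - (a%:Z * b%:Z - a%:Z - b%:Z).
Proof.
move=> h0 hr E; have [i [l [_ P0h]]] := pole_repr h0 hr.
by apply: (@Frobenius_not_repr a b a0 b0 cab i l); lia.
Qed.

Variable Q : place iota.
Hypotheses (Qz : Q z = 1) (Qf : Q f = b%:Z).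

Lemma Q_monomial i l : Q (z ^+ i * f ^+ l) = (i + b * l)%N%:Z.
Proof. by rewrite pval_monomial Qz Qf !int_mulrn; lia. Qed.

(* The monomials z^i f^l with i < b have distinct pole orders at P0, which
   exhaust all possible ones, and distinct orders at Q: h is a combination of
   monomials, one of which has the order of h at Q. *)
Lemma pole_order_ge h : h != 0 -> reg h ->
  exists i l, [/\ (i < b)%N, Q h = (i + b * l)%N%:Z & P0 h <= - (a * i + b * l)%N%:Z].
Proof.
have [s] := ubnP `|P0 h|%N; elim: s h => // s IH h hs h0 hr.
have [i [l [ib P0h]]] := pole_repr h0 hr.
have M0 := monomial_neq0 i l; set M := _ * _ in M0.
have [|c c0 hM] := rational_leading_coef P0_rat h0 M0; first by rewrite P0_monomial.
have cM0 : iota c * M != 0 by rewrite mulf_neq0 ?fmorph_eq0.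
have QcM : Q (iota c * M) = (i + b * l)%N%:Z by rewrite pvalZ // Q_monomial.
pose h' := h - iota c * M; have hE : h = iota c * M + h' by rewrite addrC subrK.
have [h'0|h'0] := eqVneq h' 0.
  by exists i, l; rewrite {1}hE h'0 addr0 QcM P0h.
have h'r : reg h'.
  by move=> R RP; rewrite vgeB ?vgeZ //; [apply: hr | apply: monomial_reg].
rewrite vgeP // -/h' in hM; have h'P := pole_ge0 h'0 h'r.
have [|i' [l' [ib' Qh' Ph']]] := IH _ _ h'0 h'r; first by lia.
have [lt|gt|E] := ltgtP (Q (iota c * M)) (Q h').
- have [_] : iota c * M + h' != 0 /\ Q (iota c * M + h') = Q (iota c * M).
    by apply: pval_add_lt => //; rewrite vgeP //; move: lt; rewrite -lezD1.
  by rewrite -hE QcM => ->; exists i, l; rewrite P0h.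
- have [_] : h' + iota c * M != 0 /\ Q (h' + iota c * M) = Q h'.
    by apply: pval_add_lt => //; rewrite vgeP //; move: gt; rewrite -lezD1.
  by rewrite addrC -hE Qh' => ->; exists i', l'; split=> //; lia.
(* Equal orders at [Q] force i = i', by reduction modulo [b], then l = l'. But [h'] has a smaller
   pole order at [P0] than this monomial, against [Ph']. *)
move: E; rewrite QcM Qh' => -[E].
have ii' : i = i'.
  by have := congr1 (modn^~ b) E; rewrite ![(_ + b * _)%N]addnC ![(b * _)%N]mulnC !modnMDl !modn_small.
have ll' : l = l' by move: E; rewrite ii'; nia.
by have := le_trans hM Ph'; rewrite P0h -ii' -ll' gerDl.
Qed.

(** With 0 <= i < b, the equation i + b l = b - 1 leaves only l = 0. *)
Lemma pole_order_pred_b h : h != 0 -> reg h -> Q h = b%:Z - 1 ->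
  P0 h <= - (a%:Z * (b%:Z - 1)).
Proof.
move=> h0 hr Qh; have [i [l [ib E Ph]]] := pole_order_ge h0 hr.
have N : (i + b * l).+1 = b by lia.
case: l => [|l] in E Ph N *; last by move: N; rewrite mulnS; lia.
by rewrite muln0 addn0 in N Ph; nia.
Qed.

End PoleOrders.

(** * Relative maximal elements *)

(** The coefficients are 1, except [x] at [j0] and, for a zero sum, -(s + x) at [j1]. Here [x]
    avoids 0 and -s, which s = 0 or a third element of [k] makes possible. *)
Lemma nonzero_coefs_sum (k : finFieldType) (T : finType) (K : {set T}) (t : bool) :
  (1 + ~~ t <= #|K|)%N -> (#|K| == 1)%N || (2 < #|k|)%N ->
  exists c : T -> k, (forall j, c j != 0) /\ (\sum_(j in K) c j != 0) = t.
Proof.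
move=> Kt Kk.
have pick s : (s == 0) || (2 < #|k|)%N -> exists x : k, x != 0 /\ s + x != 0.
  case/orP => [/eqP->|k2]; first by exists 1; rewrite add0r oner_eq0.
  have : ~~ ([set: k]%SET \subset [set 0; - s]%SET).
    apply/negP => /subset_leq_card; rewrite cardsT; apply/negP; rewrite -ltnNge.
    by apply: leq_ltn_trans k2; rewrite cards2 -ltnS; case: eqP.
  case/subsetPn => x _; rewrite !inE negb_or => /andP[x0 xs]; exists x.
  by rewrite addrC addr_eq0.
have [j0 j0K] : exists j, j \in K by apply/set0Pn; rewrite -card_gt0; lia.
case: t Kt => /= Kt.
  pose s : k := \sum_(j in K | j != j0) 1.
  have [|x [x0 sx]] := pick s.
    case/orP: Kk => [/cards1P[y Ky]|->]; last by rewrite orbT.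
    move: j0K; rewrite /s Ky inE => /eqP ->; rewrite big_pred0 ?eqxx // => j.
    by rewrite inE andbN.
  exists (fun j => if j == j0 then x else 1); split.
    by move=> j; case: ifP; rewrite ?oner_eq0.
  rewrite (bigD1 j0) //= eqxx addrC -[RHS]sx; congr (_ + _ != 0).
  by apply: eq_bigr => j /andP[_ /negbTE->].
have [j1 /setD1P[j10 j1K]] : exists j, j \in (K :\ j0)%SET.
  by apply/set0Pn; rewrite -card_gt0; move: Kt; rewrite (cardsD1 j0) j0K.
pose s : k := \sum_(j in K | (j != j0) && (j != j1)) 1.
have [|x [x0 sx]] := pick s; first by case/orP: Kk => [/eqP|->]; [lia | rewrite orbT].
exists (fun j => if j == j0 then x else if j == j1 then - (s + x) else 1); split.
  by move=> j; case: ifP => // _; case: ifP; rewrite ?oner_eq0 ?oppr_eq0.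
rewrite (bigD1 j0) //= eqxx (bigD1 j1) /=; last by rewrite j1K.
have -> : \sum_(i | (i \in K) && (i != j0) && (i != j1))
    (if i == j0 then x else if i == j1 then - (s + x) else 1) = s.
  rewrite /s; apply: eq_big => [j|j]; first by rewrite andbA.
  by rewrite -andbA => /and3P[_ /negbTE-> /negbTE->].
by rewrite (negPf j10) eqxx opprD addrAC addrCA addrN addr0 addNr eqxx.
Qed.

Section RelativeMaximal.
Variables (k : finFieldType) (F : fieldType) (iota : {rmorphism k -> F}).
Variables (a b gen m : nat) (hgen : is_genus iota gen).
Hypotheses (a0 : (0 < a)%N) (b0 : (0 < b)%N) (cab : coprime a b).
Hypothesis genE : gen = (a.-1 * b.-1 %/ 2)%N.
Hypotheses (m2 : (2 <= m)%N) (mk : (m <= #|k|)%N).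
Variables (Q : 'I_m -> place iota) (o : 'I_m).
Hypotheses (Q_inj : injective Q) (Q_rat : forall j, rational_place (Q j)).

(** Elements of [Hhat] are replaced by the functions realising them. *)
Definition nabla_pred (J : {set 'I_m}) (al : 'I_m -> int) := exists h : F,
  [/\ regular_outside Q h, h != 0 &
      forall i, if i \in J then - Q i h = al i else - Q i h < al i].

(* J is not required to be proper: the case of all indices says that al belongs
   to Hhat. *)
Definition relmax (al : 'I_m -> int) :=
  (forall j, ~ nabla_pred [set j]%SET al) /\
  (forall J : {set 'I_m}, (2 <= #|J|)%N -> nabla_pred J al).

Lemma nablaJP J (al : 'rV[int]_m) :
  nablaJ Q J al !=set0 <-> nabla_pred J (fun i => al ord0 i).
Proof.
split=> [[be [[h [hr h0 beE]] beJ]]|[h [hr h0 hJ]]].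
  exists h; split=> // i; have := beJ i; rewrite beE mxE; by case: ifP.
exists (\row_i - Q i h); split; first by exists h.
by move=> i; rewrite mxE; apply: hJ.
Qed.

Lemma relative_maximalP (al : 'rV[int]_m) :
  relative_maximal Q al <-> relmax (fun i => al ord0 i).
Proof.
have HhatP : Hhat Q al <-> nabla_pred [set: 'I_m]%SET (fun i => al ord0 i).
  split=> [[h [hr h0 ->]]|[h [hr h0 hJ]]].
    by exists h; split=> // i; rewrite inE mxE.
  exists h; split=> //; apply/rowP => i; rewrite mxE.
  by have := hJ i; rewrite inE => ->.
split=> [[Ha na nJ]|[nj nJ]].
  split=> [j /nablaJP[be beJ]|J J2].
    suff : nabla Q al be by rewrite na.
    by exists j.
  have [->|JT] := eqVneq J [set: 'I_m]%SET; first exact/HhatP.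
  by apply/nablaJP; apply: nJ => //; rewrite properT.
split=> [||J _ J2]; last exact/nablaJP/nJ.
  by apply/HhatP; apply: nJ; rewrite cardsT card_ord.
rewrite -subset0 => be [j _ beJ]; apply: (nj j); apply/nablaJP.
by exists be.
Qed.

Lemma regular_outsideM x y :
  regular_outside Q x -> (forall R, (forall i, R <> Q i) -> vge R 0 y) ->
  regular_outside Q (x * y).
Proof.
move=> xr yr R RQ; have /vgeM/(_ (yr R RQ)) : vge R 0 x.
  by case: (xr R RQ) => [->|x0]; [apply: vge0 | rewrite /vge x0 orbT].
by rewrite addr0; case/orP => [/eqP|]; [left | right].
Qed.

Lemma nabla_pred_shift u J al al' : u != 0 ->
  (forall R, (forall i, R <> Q i) -> R u = 0) ->
  (forall i, al' i = al i - Q i u) -> nabla_pred J al -> nabla_pred J al'.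
Proof.
move=> u0 ur al'E [h [hr h0 hJ]]; exists (h * u); split.
- by apply: regular_outsideM => // R /ur E; rewrite /vge E lexx orbT.
- by rewrite mulf_neq0.
move=> i; have := hJ i; rewrite al'E pvalM // opprD.
by case: ifP => _; [move=> -> | rewrite ltrD2r].
Qed.

(** Multiplication by [u], a unit outside the tuple, translates the nonempty sets; emptiness is
    carried over by [u^-1]. *)
Lemma relmax_shift u al al' : u != 0 ->
  (forall R, (forall i, R <> Q i) -> R u = 0) ->
  (forall i, al' i = al i - Q i u) -> relmax al -> relmax al'.
Proof.
move=> u0 ur al'E [nj nJ]; split=> [j|J /nJ].
  move=> jal'; apply: (nj j); apply: (@nabla_pred_shift u^-1 _ al') => //.
  - by rewrite invr_eq0.
  - by move=> R /ur; rewrite pvalV => ->; rewrite oppr0.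
  - by move=> i; rewrite al'E pvalV opprK subrK.
exact: nabla_pred_shift u0 ur al'E.
Qed.

Variables (z : F) (w : 'I_m -> F).
Hypotheses (z0 : z != 0) (w0 : forall j, w j != 0).
Hypotheses (oz : Q o z = - a%:Z) (Qz : forall j, j != o -> Q j z = 1)
  (zr : forall R, R <> Q o -> 0 <= R z).
Hypotheses (ow : forall j, j != o -> Q o (w j) = - b%:Z)
  (Qw : forall j, j != o -> Q j (w j) = b%:Z)
  (wr : forall j R, j != o -> R <> Q o -> R <> Q j -> R (w j) = 0).

Lemma exists_neq_o : exists j, j != o.
Proof.
exists (if val o == 0%N then Ordinal m2 else Ordinal (ltnW m2)).
by rewrite -val_eqE eq_sym; case: (val o).
Qed.

Lemma Qw' i j : i != o -> j != o -> i != j -> Q i (w j) = 0.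
Proof. by move=> io jo ij; apply: wr => // /Q_inj/eqP; apply/negP. Qed.

Lemma reg_regular_outside h : regular_outside Q h ->
  (forall j, j != o -> 0 <= Q j h) -> reg (Q o) h.
Proof.
move=> hr hQ R RQ.
have [[j RE]|nR] := pselect (exists j, R = Q j).
  rewrite RE /vge hQ ?orbT //; apply/eqP => jo; apply: RQ; rewrite RE jo //.
case: (hr R) => [i RE|->|R0]; first by apply: nR; exists i.
  exact: vge0.
by rewrite /vge R0 orbT.
Qed.

Lemma z_reg : reg (Q o) z.
Proof. by move=> R /zr; rewrite /vge => ->; rewrite orbT. Qed.

Lemma w_reg j : j != o -> reg (Q o) (w j).
Proof.
move=> jo R RQ; have [->|RQj] := pselect (R = Q j).
  by rewrite /vge Qw // orbT.
by rewrite /vge wr // orbT.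
Qed.

Lemma zX_regular_outside n R : (forall i, R <> Q i) -> vge R 0 (z ^+ n).
Proof. by move=> RQ; apply: (regX _ z_reg); apply: RQ. Qed.

Lemma Q_zX j n : j != o -> Q j (z ^+ n) = n%:Z.
Proof. by move=> jo; rewrite pvalX // Qz // natz. Qed.

Lemma o_zX n : Q o (z ^+ n) = - (a%:Z * n%:Z).
Proof. by rewrite pvalX // oz int_mulrn mulNr. Qed.

(* h z^(i-1) w_j is regular outside Q o, with order b - 1 at Q j. *)
Lemma pole_order_bound h i j : regular_outside Q h -> h != 0 -> j != o ->
  (0 < i)%N -> - Q j h = i%:Z ->
  (forall l, l != o -> l != j -> - Q l h < i%:Z) ->
  a%:Z * (b%:Z - i%:Z) - b%:Z <= - Q o h.
Proof.
move=> hr h0 jo i0 hj hl.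
have zi0 : z ^+ i.-1 != 0 by rewrite expf_neq0.
pose h' := h * z ^+ i.-1 * w j.
have h'0 : h' != 0 by rewrite !mulf_neq0.
have h'E (R : place iota) : R h' = R h + R (z ^+ i.-1) + R (w j).
  by rewrite !pvalM ?mulf_neq0.
have h'r : reg (Q o) h'.
  apply: reg_regular_outside => [|l lo].
    apply: regular_outsideM => [|R RQ]; last exact: w_reg.
    by apply: regular_outsideM => // R; apply: zX_regular_outside.
  (* At [Q j] the order is -i + (i - 1) + b = b - 1; at the other [Q l], that of [h] is at least 1 -
     i, which z^(i-1) compensates. *)
  rewrite h'E Q_zX //; have [->|lj] := eqVneq l j; first by rewrite Qw //; lia.
  by rewrite Qw' // addr0; have := hl l lo lj; lia.
have := pole_order_pred_b hgen a0 b0 cab genE (Q_rat o) z0 (w0 j) oz (ow jo)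
  z_reg (w_reg jo) (Qz jo) (Qw jo) h'0 h'r.
rewrite !h'E Q_zX // o_zX Qw // ow // => H.
have {H} : Q o h + - (a%:Z * (i.-1)%:Z) + - b%:Z <= - (a%:Z * (b%:Z - 1)).
  by apply: H; lia.
have -> : (i.-1)%:Z = i%:Z - 1 by lia.
by rewrite !mulrBr; lia.
Qed.

(** This is beta^i for 0 < i < b; the case i = b serves for beta^0. *)
Definition gam (i : nat) (j : 'I_m) : int :=
  if j == o then a%:Z * (b%:Z - i%:Z) - b%:Z else i%:Z.

Lemma gam_no_nabla i j : (0 < i <= b)%N -> ~ nabla_pred [set j]%SET (gam i).
Proof.
move=> /andP[i0 ib] [h [hr h0 hJ]].
have hj : - Q j h = gam i j by have := hJ j; rewrite inE eqxx.
have hl l : l != j -> - Q l h < gam i l.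
  by move=> lj; have := hJ l; rewrite inE (negPf lj).
have [jo|jo] := eqVneq j o; last first.
  have := hl o; rewrite eq_sym => /(_ jo).
  rewrite /gam eqxx ltNge => /negP; apply.
  apply: (pole_order_bound hr h0 jo i0); first by rewrite hj /gam (negPf jo).
  by move=> l lo lj; have := hl l lj; rewrite /gam (negPf lo).
subst j; have zi0 : z ^+ i.-1 != 0 by rewrite expf_neq0.
have [j1 j1o] := exists_neq_o.
(* The pole order of h z^(i-1) at [Q o] would be a (b - i) - b + a (i - 1) = a b - a - b. *)
apply: (pole_order_neq_Frobenius hgen a0 b0 cab genE (Q_rat o) z0 (w0 j1) oz
  (ow j1o) z_reg (w_reg j1o) (mulf_neq0 h0 zi0)).
  apply: reg_regular_outside => [|l lo].
    by apply: regular_outsideM => // R; apply: zX_regular_outside.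
  by rewrite pvalM // Q_zX //; have := hl l lo; rewrite /gam (negPf lo); lia.
rewrite pvalM // o_zX; move: hj; rewrite /gam eqxx.
have -> : (i.-1)%:Z = i%:Z - 1 by lia.
by rewrite !mulrBr; lia.
Qed.

(* The inverses of the w j are rescaled to have the same leading coefficient at
   Q o, so that a combination of them has order more than b there iff its
   coefficients sum to 0. *)
Lemma exists_normalised_inverses : exists e (v : 'I_m -> F),
  [/\ e != 0, Q o e = b%:Z & forall j, j != o ->
   [/\ v j != 0, forall R, R <> Q j -> vge R 0 (v j), Q j (v j) = - b%:Z &
    vge (Q o) (b%:Z + 1) (e - v j)]].
Proof.
have [j1 j1o] := exists_neq_o; pose e := (w j1)^-1.
have e0 : e != 0 by rewrite invr_eq0.
have eo : Q o e = b%:Z by rewrite pvalV ow // opprK.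
have /choice[c cP] : forall j, exists c, j != o ->
    c != 0 /\ vge (Q o) (b%:Z + 1) (e - iota c * (w j)^-1).
  move=> j; have [|jo] := eqVneq j o; first by exists 0.
  have [||c c0 cE] := @rational_leading_coef _ _ _ (Q o) e (w j)^-1 (Q_rat o) e0.
  - by rewrite invr_eq0.
  - by rewrite eo pvalV ow // opprK.
  by exists c => _; split=> //; rewrite -eo.
exists e, (fun j => iota (c j) * (w j)^-1); split=> // j jo.
have [c0 cE] := cP j jo; split=> //.
- by rewrite mulf_neq0 ?fmorph_eq0 ?invr_eq0.
- move=> R RQ; apply: vgeZ; rewrite vgeP ?invr_eq0 // pvalV.
  have [->|Ro] := pselect (R = Q o); first by rewrite ow // opprK.
  by rewrite wr // oppr0.
by rewrite pvalZ // pvalV Qw.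
Qed.

(* Witnessed by z^(b-i) times the sum of the c_j v_j over the j != o of J, where
   the sum of the c_j vanishes iff o is not in J; m <= #|k| provides the c_j. *)
Lemma gam_nabla i (J : {set 'I_m}) : (0 < i <= b)%N -> (2 <= #|J|)%N ->
  nabla_pred J (gam i).
Proof.
move=> /andP[i0 ib] J2.
have zS_lt (x : int) : 0 <= x -> - (b - i)%N%:Z - x < i%:Z by lia.
have [e [v [e0 eo vP]]] := exists_normalised_inverses.
have JE := cardsD1 o J; set K := (J :\ o)%SET in JE.
have cardK (t : bool) x y : x = (t + y)%N -> (2 <= x)%N -> (1 + ~~ t <= y)%N.
  by case: t => /=; lia.
have [||c [c0 cS]] := @nonzero_coefs_sum k _ K (o \in J).
- exact: cardK JE J2.
(* If [K] is not a singleton, then 2 <= #|K| < m <= #|k|, because [K] misses [o]. *)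
- rewrite -implyNb; apply/implyP => K1; apply: leq_trans mk.
  suff Km : (#|K| < m)%N.
    apply: (leq_trans _ Km); rewrite ltnS ltn_neqAle eq_sym K1.
    by apply: leq_trans (cardK _ _ _ JE J2); rewrite leq_addr.
  rewrite -[m in X in (_ < X)%N]card_ord -cardsT; apply: proper_card.
  by rewrite properE finset.subsetT; apply/subsetPn; exists o; rewrite !inE ?eqxx.
have KP j : j \in K -> j != o by case/setD1P.
pose S := \sum_(j in K) iota (c j) * v j.
have SK j : j \in K -> S != 0 /\ Q j S = - b%:Z.
  move=> jK; have jo := KP j jK; have [vj0 _ Qv _] := vP j jo.
  rewrite /S (bigD1 j) //= -Qv -(pvalZ (Q j) (v j) (c0 j)).
  apply: pval_add_lt; first by rewrite mulf_neq0 ?fmorph_eq0.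
  apply: vge_sum => l /andP[lK lj]; apply: vgeZ.
  have [_ vl _ _] := vP l (KP l lK); apply: (@vgeW _ _ _ _ 0); last first.
    by apply: vl => /Q_inj E; rewrite E eqxx in lj.
  by rewrite pvalZ // Qv addrC subr_le0.
have Sr R : (forall j, j \in K -> R <> Q j) -> vge R 0 S.
  move=> RK; apply: vge_sum => l lK; apply: vgeZ.
  by have [_ vl _ _] := vP l (KP l lK); apply/vl/RK.
have S0 : S != 0.
  have /set0Pn[j /SK[]//] : K != finset.set0.
  by rewrite -card_gt0; apply: leq_trans (cardK _ _ _ JE J2); rewrite leq_addr.
(* Up to terms of order above [b] at [Q o], [S] is [e] times the sum of the [c j]. *)
have SE : S = iota (\sum_(j in K) c j) * e - \sum_(j in K) iota (c j) * (e - v j).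
  rewrite rmorph_sum mulr_suml -sumrB; apply: eq_bigr => j _.
  by rewrite -mulrBr opprB addrC subrK.
have Se : vge (Q o) (b%:Z + 1) (\sum_(j in K) iota (c j) * (e - v j)).
  by apply: vge_sum => j jK; apply: vgeZ; have [] := vP j (KP j jK).
have So : if o \in J then Q o S = b%:Z else b%:Z < Q o S.
  case: ifP cS => _ cS.
    have ie0 : iota (\sum_(j in K) c j) * e != 0 by rewrite mulf_neq0 ?fmorph_eq0.
    have /(pval_add_lt ie0)[_] : vge (Q o) (Q o (iota (\sum_(j in K) c j) * e) + 1)
        (- \sum_(j in K) iota (c j) * (e - v j)) by rewrite pvalZ // eo; apply: vgeN.
    by rewrite -SE pvalZ // eo.
  move/negbFE/eqP: cS => cS; move: Se SE; rewrite cS rmorph0 mul0r sub0r => Se SE.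
  by move/vgeN: Se; rewrite -SE vgeP // -lezD1.
have zb0 : z ^+ (b - i) != 0 by rewrite expf_neq0.
have QM j : - Q j (z ^+ (b - i) * S) = - Q j (z ^+ (b - i)) - Q j S.
  by rewrite pvalM // opprD.
exists (z ^+ (b - i) * S); split; last 1 first.
- move=> j; rewrite QM /gam; have [->|jo] := eqVneq j o.
    rewrite o_zX opprK -subzn //; move: So.
    by case: (o \in J) => [-> //|]; rewrite ltrD2l ltrN2.
  rewrite Q_zX //; have [jJ|jJ] := boolP (j \in J).
    have [|_ ->] := SK j; first by rewrite !inE jo.
    by rewrite -subzn // opprB opprK subrK.
  have : vge (Q j) 0 S.
    by apply: Sr => l lK /Q_inj jl; move: lK jJ; rewrite jl !inE => /andP[_ ->].
  by rewrite vgeP // => /zS_lt.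
- rewrite mulrC; apply: regular_outsideM => [R RQ|R]; last exact: zX_regular_outside.
  by case/orP: (Sr R (fun j _ => RQ j)) => [/eqP|]; [left | right].
- by rewrite mulf_neq0.
Qed.

Lemma gam_relmax i : (0 < i <= b)%N -> relmax (gam i).
Proof. by move=> ib; split=> [j|J J2]; [apply: gam_no_nabla | apply: gam_nabla]. Qed.

(** Functions with prescribed poles pin down [al o] from both sides; another coordinate below [i]
    then contradicts [pole_order_bound]. *)
Lemma relmax_gam al i j : relmax al -> (0 < i <= b)%N -> j != o -> al j = i%:Z ->
  (forall l, l != o -> i%:Z - b%:Z < al l <= i%:Z) -> al =1 gam i.
Proof.
move=> [nj nJ] /andP[i0 ib] jo alj all_.
(* [pole_order_bound] for an [h] that may also reach [al l] at one more index [l]: this is harmless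
   if [al l < i], or if l = o, where that bound asks for nothing. *)
have lower h l : regular_outside Q h -> h != 0 -> (forall l', l' != l ->
    l' != j -> - Q l' h < al l') -> l != j -> al l < i%:Z \/ l = o ->
    - Q l h <= al l -> - Q j h = al j -> a%:Z * (b%:Z - i%:Z) - b%:Z <= - Q o h.
  move=> hr h0 hl lj li Ql Qj; apply: (pole_order_bound hr h0 jo i0); first by rewrite Qj.
  move=> l' l'o l'j; have [l'l|l'l] := eqVneq l' l.
    by subst l'; case: li => [|lo]; [lia | rewrite lo eqxx in l'o].
  by have := hl _ l'l l'j; have := all_ _ l'o; lia.
have alo : al o = gam i o.
  rewrite /gam eqxx; apply/eqP; rewrite eq_le; apply/andP; split.
    (* Otherwise z^(b-i) v_j lies in the nabla of {j}: off [o] and [j] its pole orders are at most i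
       - b, which is below [al l]. *)
    rewrite leNgt; apply/negP => lt_al; apply: (nj j).
    have [e [v [e0 eo /(_ j jo)[v0 vr Qv ve]]]] := exists_normalised_inverses.
    have zb0 : z ^+ (b - i) != 0 by rewrite expf_neq0.
    have vo : vge (Q o) b%:Z (v j).
      rewrite -[v j](subKr e); apply: vgeB; first by rewrite vgeP // eo.
      by apply: vgeW ve; lia.
    exists (z ^+ (b - i) * v j); split=> [||l]; last 1 first.
    - rewrite inE pvalM // opprD; have [->|lj] := eqVneq l j.
        by rewrite Q_zX // Qv alj; lia.
      have [lo|lo] := eqVneq l o.
        rewrite lo o_zX opprK -subzn //; apply: le_lt_trans lt_al.
        by rewrite lerD2l lerN2 -vgeP.
      have := vr (Q l) (fun E => negP lj (introT eqP (Q_inj E))).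
      by rewrite vgeP // Q_zX //; have := all_ l lo; lia.
    - rewrite mulrC; apply: regular_outsideM => [R RQ|R]; last exact: zX_regular_outside.
      by case/orP: (vr R (RQ j)) => [/eqP|]; [left | right].
    - by rewrite mulf_neq0.
  have [|h [hr h0 hJ]] := nJ [set o; j]%SET; first by rewrite cards2 eq_sym jo.
  have ho : - Q o h = al o by have := hJ o; rewrite !inE eqxx.
  rewrite -ho; apply: (lower h o) => //; rewrite 1?eq_sym ?ho //; last 2 first.
  - by right.
  - by have := hJ j; rewrite !inE eqxx orbT.
  by move=> l' l'o l'j; have := hJ l'; rewrite !inE (negPf l'o) (negPf l'j).
move=> l; have [->//|lo] := eqVneq l o.
rewrite /gam (negPf lo); have [->//|lj] := eqVneq l j.
apply/eqP; rewrite eq_le; have /andP[_ -> /=] := all_ l lo.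
rewrite leNgt; apply/negP => li.
(* Here [h] reaches [al] at [j] and [l] only, so its pole order at [Q o] is below [al o], the value
   of the bound. *)
have [|h [hr h0 hJ]] := nJ [set j; l]%SET; first by rewrite cards2 eq_sym lj.
have := hJ o; rewrite !inE eq_sym (negPf jo) eq_sym (negPf lo) /= alo /gam eqxx ltNge => /negP; apply.
apply: (lower h l) => //.
- by move=> l' l'l l'j; have := hJ l'; rewrite !inE (negPf l'l) (negPf l'j).
- by left.
- by have := hJ l; rewrite !inE eqxx orbT => ->.
- by have := hJ j; rewrite !inE eqxx => ->.
Qed.

Lemma prod_w_neq0 : \prod_(j | j != o) w j != 0.
Proof. by apply/prodf_neq0. Qed.

Lemma Q_prod_w i : i != o -> Q i (\prod_(j | j != o) w j) = b%:Z.
Proof.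
move=> io; rewrite pval_prod // (bigD1 i) //= Qw // big1 ?addr0 // => j /andP[jo ji].
by rewrite Qw' // eq_sym.
Qed.

Lemma o_prod_w : Q o (\prod_(j | j != o) w j) = - (b%:Z * (m%:Z - 1)).
Proof.
rewrite pval_prod // (eq_bigr (fun=> - b%:Z)) => [|j /ow //].
rewrite sumr_const cardC1 card_ord int_mulrn mulNr; congr (- (_ * _)).
by rewrite -subn1 -subzn // ltnW.
Qed.

Lemma prod_w_outside R : (forall i, R <> Q i) -> R (\prod_(j | j != o) w j) = 0.
Proof. by move=> RQ; rewrite pval_prod //; apply: big1 => j jo; apply: wr. Qed.

(* gam0 is the translate of gam b by the divisor of the product of the w j. *)
Definition gam0 (j : 'I_m) : int := if j == o then b%:Z * (m%:Z - 2) else 0.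

(** At [o] this reads b (m - 2) = -b + b (m - 1). *)
Lemma gam0E j : gam0 j = gam b j - Q j (\prod_(l | l != o) w l).
Proof.
rewrite /gam0 /gam; have [->|jo] := eqVneq j o; last by rewrite Q_prod_w // subrr.
by rewrite o_prod_w; lia.
Qed.

Lemma gam0_relmax : relmax gam0.
Proof.
apply: (relmax_shift prod_w_neq0 prod_w_outside gam0E).
by apply: gam_relmax; rewrite b0 leqnn.
Qed.

(** If some coordinate off [o] is positive, the largest one is [i]. If all vanish, translation by
    the product of the [w j] turns them into [b], and [relmax_gam] applies with i = b. *)
Lemma relmax_cases al : relmax al -> (forall j, j != o -> 0 <= al j < b%:Z) ->
  al =1 gam0 \/ exists i, (0 < i < b)%N /\ al =1 gam i.
Proof.
move=> al_max al_b; have [j1 j1o] := exists_neq_o.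
have [[j [jo alj]]|al0] := pselect (exists j, j != o /\ 0 < al j); last first.
  left=> j; rewrite gam0E; apply/eqP; rewrite -subr_eq opprK; apply/eqP.
  have V0 : (\prod_(l | l != o) w l)^-1 != 0 by rewrite invr_eq0 prod_w_neq0.
  have alE l : l != o -> al l = 0.
    move=> lo; apply/eqP; rewrite eq_le; have /andP[-> _] := al_b l lo.
    by rewrite andbT leNgt; apply/negP => l0; apply: al0; exists l.
  apply: (@relmax_gam (fun l => al l + Q l (\prod_(l | l != o) w l)) b j1) => //.
  - apply: (relmax_shift V0 _ _ al_max) => [R /prod_w_outside|l].
      by rewrite pvalV => ->; rewrite oppr0.
    by rewrite pvalV opprK.
  - by rewrite b0 leqnn.
  - by rewrite Q_prod_w // alE // add0r.
  - by move=> l lo; rewrite Q_prod_w // alE // add0r subrr lexx ltz_nat b0.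
right; case: (@arg_maxP _ _ _ j (fun l => l != o) al jo) => i io imax.
have ai : 0 < al i by apply: lt_le_trans alj (imax j jo).
have /andP[_ aib] := al_b i io.
exists `|al i|%N; split; first by lia.
apply: (relmax_gam al_max (j := i)) => //; first by lia.
  by rewrite gtz0_abs.
move=> l lo; rewrite gtz0_abs //; have := imax l lo; have := al_b l lo.
by rewrite /=; lia.
Qed.

End RelativeMaximal.

(** * From the linear equivalences to the functions [z] and [w] *)

Lemma linequiv_function (k F : fieldType) (iota : {rmorphism k -> F})
    (D E : {freeg (place iota) / int}) : linequiv D E ->
  exists h : F, h != 0 /\ forall R : place iota, R h = coeff R E - coeff R D.
Proof.
case=> h [h0 hE]; exists h^-1; rewrite invr_eq0; split=> // R.
by rewrite pvalV -hE coeffB opprB.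
Qed.

Theorem theorem4p2 (k : finFieldType) (F : fieldType)
  (iota : {rmorphism k -> F})
  (f g : {poly k}) (a b gen m : nat) (P : 'I_a.+1 -> place iota)
  (hF : function_field iota)
  (hirr : geometrically_irreducible iota)
  (hmodel : plane_model iota f g)
  (hf : size f = a.+1) (hg : size g = b.+1) (hab : coprime a b)
  (hgen : is_genus iota gen) (hgen0 : (0 < gen)%N)
  (hgenE : gen = (a.-1 * b.-1 %/ 2)%N)
  (hPinj : injective P) (hPrat : forall j : 'I_a.+1, rational_place (P j))
  (hPa : linequiv (<< P ord0 >> *+ a) (\sum_(j < a.+1 | j != ord0) << P j >>))
  (hPb : forall j : 'I_a.+1, j != ord0 ->
     linequiv (<< P ord0 >> *+ b) (<< P j >> *+ b))
  (hbmin : forall c : nat, (0 < c)%N ->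
     (forall j : 'I_a.+1, j != ord0 -> linequiv (<< P ord0 >> *+ c) (<< P j >> *+ c)) ->
     (b <= c)%N)
  (hm2 : (2 <= m)%N) (hm : (m <= a.+1)%N) (hq : (m <= #|k|)%N) :
  Lambdahat (fun i : 'I_m => P (widen_ord hm i)) `&` Cset b m
    = [set beta a b m i | i in [set i | (i < b)%N]].
Proof.
have a2 : (1 < a)%N by move: hgen0; rewrite hgenE; case: (a) => [|[|]].
have b2 : (1 < b)%N.
  by move: hgen0; rewrite hgenE; case: (b) => [|[|]] //; rewrite muln0.
have a0 := ltnW a2; have b0 := ltnW b2.
pose o : 'I_m := Ordinal (ltnW hm2); pose Q (i : 'I_m) := P (widen_ord hm i).
have oE (j : 'I_m) : (j == 0%N :> nat) = (j == o) by [].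
have Q_inj : injective Q by move=> i j /hPinj [] /val_inj.
have wo : widen_ord hm o = ord0 by apply: val_inj.
have wj j : j != o -> widen_ord hm j != ord0 by [].
(* [z] may vanish at points P_j with j > m as well; outside the tuple only its regularity
   matters. *)
have [z [z0 zE]] := linequiv_function hPa.
have {}zE (R : place iota) : R z = \sum_(j < a.+1 | j != ord0) (P j == R)%:R - (P ord0 == R)%:R *+ a.
  rewrite zE coeffMn coeff1; congr (_ - _); rewrite (raddf_sum (coeff R)).
  by apply: eq_bigr => j _; apply: coeff1.
have PE (i j : 'I_a.+1) : (P i == P j) = (i == j) by apply: inj_eq.
have oz : Q o z = - a%:Z.
  rewrite zE /Q wo eqxx big1 ?sub0r ?natz // => j j0.
  by rewrite PE (negPf j0).
have Qz j : j != o -> Q j z = 1.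
  move=> /wj jo; rewrite zE /Q PE eq_sym (negPf jo) mul0rn subr0.
  rewrite (bigD1 (widen_ord hm j)) //= eqxx big1 ?addr0 // => l /andP[_ lj].
  by rewrite PE (negPf lj).
have zr (R : place iota) : R <> Q o -> 0 <= R z.
  rewrite /Q wo zE => RP; have [E|_] := eqVneq (P ord0) R; first by case: RP.
  by rewrite mul0rn subr0; apply: sumr_ge0 => j _; apply: ler0n.
(* The value 1 at [o] is a filler that keeps every [w j] nonzero. *)
have /choice[w wP] : forall j, exists h : F, h != 0 /\ (j != o ->
    forall R : place iota, R h = (Q j == R)%:R *+ b - (Q o == R)%:R *+ b).
  move=> j; have [|/wj jo] := eqVneq j o; first by exists 1; rewrite oner_eq0.
  have [h [h0 hE]] := linequiv_function (hPb _ jo); exists h; split=> // _ R.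
  by rewrite hE !coeffMn !coeff1 /Q wo.
have w0 j : w j != 0 by case: (wP j).
have wE j : j != o -> forall R : place iota, R (w j) = (Q j == R)%:R *+ b - (Q o == R)%:R *+ b.
  by case: (wP j).
have ow j : j != o -> Q o (w j) = - b%:Z.
  by move=> jo; rewrite wE // !(inj_eq Q_inj) (negPf jo) eqxx mul0rn sub0r natz.
have Qw j : j != o -> Q j (w j) = b%:Z.
  by move=> jo; rewrite wE // !(inj_eq Q_inj) [o == j]eq_sym (negPf jo) eqxx mul0rn subr0 natz.
have wr j (R : place iota) : j != o -> R <> Q o -> R <> Q j -> R (w j) = 0.
  move=> jo /eqP Ro /eqP Rj; rewrite wE // [_ j == R]eq_sym (negPf Rj) [_ o == R]eq_sym (negPf Ro).
  by rewrite !mul0rn subrr.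
have Q_rat j : rational_place (Q j) by apply: hPrat.
have betaE i j : beta a b m i ord0 j = if i == 0%N then gam0 b o j else gam a b o i j.
  by rewrite mxE /gam0 /gam !oE.
apply/seteqP; split=> [al [/(relative_maximalP hm2) al_max alC]|_ [i ib <-]].
  have [alE|[i [/andP[i0 ib] alE]]] := relmax_cases hgen a0 b0 hab hgenE hm2 hq
    Q_inj Q_rat z0 w0 oz Qz zr ow Qw wr al_max alC.
    by exists 0%N => //; apply/rowP => j; rewrite betaE -alE.
  by exists i => //; apply/rowP => j; rewrite betaE -alE eqn0Ngt i0.
split.
  apply/(relative_maximalP hm2).
  have -> : (fun j => beta a b m i ord0 j) = if i == 0%N then gam0 b o else gam a b o i.
    by apply/funext => j; rewrite betaE; case: ifP.
  have [_|i0] := eqVneq i 0%N.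
    exact: (gam0_relmax hgen a0 b0 hab hgenE hm2 hq Q_inj Q_rat z0 w0 oz Qz zr ow Qw wr).
  apply: (gam_relmax hgen a0 b0 hab hgenE hm2 hq Q_inj Q_rat z0 w0 oz Qz zr ow Qw wr).
  by rewrite lt0n i0 ltnW.
move=> j jo; rewrite betaE /gam0 /gam -oE (negPf jo).
by case: ifP => _; rewrite ?ltz_nat ?lexx ?b0.
Qed.
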